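(* Let $\mathcal{M}=(E,\rho)$ be a $q$-polymatroid. Fix a non-degenerate symmetric bilinear form $\langle\cdot\mid\cdot\rangle$ on $E$ and let $\mathcal{M}^*=(E,\rho^* )$ be the dual of $\mathcal{M}$ with respect to $\langle\cdot\mid\cdot\rangle$. (a) If $\mathcal{M}$ is a $q$-matroid, then for every basis $B$ of $\mathcal{M}$ the orthogonal space $B^\perp$ is a basis of $\mathcal{M}^*$. (b) Let $\mu$ be a denominator of $\mathcal{M}$. Suppose there exists a $\mu$-basis $B$ of $\mathcal{M}$ such that the orthogonal space $B^\perp$ is a $\mu$-basis of $\mathcal{M}^*$. Then $\mathcal{M}$ is a $q$-matroid.
   Context: Throughout, $\mathbb{F}=\mathbb{F}_q$ is a finite field and $E$ is a finite-dimensional $\mathbb{F}$-vector space. $V\leq W$ means that $V$ is a subspace of $W$, and $\mathcal{V}(E)$ is the set of all subspaces of $E$. A $q$-rank function on $E$ is a map $\rho:\mathcal{V}(E)\to\mathbb{Q}_{\geq0}$ such that for all $V,W\in\mathcal{V}(E)$: (R1) $0\leq\rho(V)\leq\dim V$; (R2) $V\leq W$ implies $\rho(V)\leq\rho(W)$; (R3) $\rho(V+W)+\rho(V\cap W)\leq\rho(V)+\rho(W)$. A $q$-polymatroid on $E$ is a pair $\mathcal{M}=(E,\rho)$ with $\rho$ a $q$-rank function on $E$. A number $\mu\in\mathbb{Q}_{>0}$ is a denominator of $\mathcal{M}$ if $\mu\rho(V)\in\mathbb{N}_0$ for all $V\in\mathcal{V}(E)$. The smallest denominator is called the principal denominator;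 if $\rho$ is the zero map, the principal denominator is declared to be $1$. A $q$-matroid is a $q$-polymatroid with principal denominator $1$, that is, one whose rank function takes only integer values. Let $\mathcal{M}=(E,\rho)$ be a $q$-polymatroid with denominator $\mu$. A space $I\in\mathcal{V}(E)$ is $\mu$-independent if $\rho(J)\geq\frac{\dim J}{\mu}$ for all subspaces $J\leq I$. A $\mu$-basis of $\mathcal{M}$ is a $\mu$-independent subspace of $E$ of maximal dimension among all $\mu$-independent subspaces of $E$. If $\mu$ is the principal denominator, the prefix $\mu$ is dropped; thus a basis of a $q$-matroid means a $1$-basis, and in a $q$-matroid a space $V$ is ($1$-)independent if and only if $\rho(V)=\dim V$. Given a non-degenerate symmetric bilinear form $\langle\cdot\mid\cdot\rangle$ on $E$, put $V^\perp=\{w\in E\mid \langle v\mid w\rangle=0\text{ for all }v\in V\}$ for $V\in\mathcal{V}(E)$. The dual of $\mathcal{M}=(E,\rho)$ with respect to the form is $\mathcal{M}^*=(E,\rho^* )$, where $\rho^*(V)=\dim V+\rho(V^\perp)-\rho(E)$. It is known that $\mathcal{M}^*$ is again a $q$-polymatroid, that $\mathcal{M}^{**}=\mathcal{M}$, and that $\mathcal{M}$ and $\mathcal{M}^*$ have the same set of denominators; in particular the dual of a $q$-matroid is a $q$-matroid.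
   Formalization: In (b), μ is also required to be a denominator of M* (automatic for integral μ); for non-integral μ this can fail: dim E = 1, ρ(E) = 4/5, μ = 5/4 gives μρ*(E) = 1/4, and with B = E the inequalities for both μ-bases hold although M is not a q-matroid. *)

(* Defs.v *)
From HB Require Import structures.
From mathcomp Require Import all_boot all_order all_algebra.

Set Implicit Arguments.
Unset Strict Implicit.
Unset Printing Implicit Defensive.

Import Order.TTheory GRing.Theory Num.Theory.
Local Open Scope ring_scope.

(* A q-polymatroid (E, rho) on E is given by its q-rank function rho. *)
Definition q_rank_function (F : finFieldType) (E : vectType F)
    (rho : {vspace E} -> rat) : Prop :=
  [/\ forall V, 0 <= rho V <= (\dim V)%:R,
      forall V W, (V <= W)%VS -> rho V <= rho W
    & forall V W, rho (V + W)%VS + rho (V :&: W)%VS <= rho V + rho W].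

Definition denominator (F : finFieldType) (E : vectType F)
    (rho : {vspace E} -> rat) (mu : rat) : Prop :=
  0 < mu /\ forall V, mu * rho V \is a Num.nat.

Definition principal_denominator (F : finFieldType) (E : vectType F)
    (rho : {vspace E} -> rat) (mu : rat) : Prop :=
  ((forall V, rho V = 0) -> mu = 1) /\
  (~ (forall V, rho V = 0) ->
     denominator rho mu /\ forall nu, denominator rho nu -> mu <= nu).

Definition q_matroid (F : finFieldType) (E : vectType F)
    (rho : {vspace E} -> rat) : Prop :=
  q_rank_function rho /\ principal_denominator rho 1.

Definition mu_independent (F : finFieldType) (E : vectType F)
    (rho : {vspace E} -> rat) (mu : rat) (I : {vspace E}) : Prop :=
  forall J, (J <= I)%VS -> (\dim J)%:R / mu <= rho J.

(* The notion of a mu-basis presupposes that mu is a denominator of the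
   q-polymatroid. The first conjunct records this. It matters for the dual: a
   non-integral denominator of rho need not be one of dual_rank f rho. *)
Definition mu_basis (F : finFieldType) (E : vectType F)
    (rho : {vspace E} -> rat) (mu : rat) (B : {vspace E}) : Prop :=
  [/\ denominator rho mu,
      mu_independent rho mu B
    & forall I, mu_independent rho mu I -> (\dim I <= \dim B)%N].

Definition basis (F : finFieldType) (E : vectType F)
    (rho : {vspace E} -> rat) (B : {vspace E}) : Prop :=
  exists2 mu, principal_denominator rho mu & mu_basis rho mu B.

Definition dual_rank (F : finFieldType) (E : vectType F) (f : {symmetric E})
    (rho : {vspace E} -> rat) (V : {vspace E}) : rat :=
  (\dim V)%:R + rho (orthov f V) - rho fullv.

(* Main.v *)
Require Import Defs.
From HB Require Import structures.
From mathcomp Require Import all_boot all_order all_algebra.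
From mathcomp Require Import zify lra.
From Stdlib Require Import Classical.

Import Order.TTheory GRing.Theory Num.Theory.
Local Open Scope ring_scope.

Set Implicit Arguments.
Unset Strict Implicit.
Unset Printing Implicit Defensive.

(** The whole proof turns on one fact ([mu_basis_rank]): a [mu]-basis [B]
    carries the full rank, [rho B = rho E].  If [v] lies outside [B], then
    [B + <v>] is [mu]-dependent, and a subspace [J] violating independence has
    [mu * rho J < dim J].  Since [mu * rho J] is an integer it is at most
    [dim J - 1 = dim (J :&: B)], which independence of [B] bounds by
    [mu * rho (J :&: B)].  Hence [rho J = rho (J :&: B)], and submodularity gives
    [rho (B + <v>) = rho B]; submodularity again propagates this from single
    vectors to all of [E].

    Part (a).  Here [rho B = dim B = rho E], so [rho* B^perp = dim B^perp], which
    makes [B^perp] independent.  If [I] is independent in the dual then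
    [rho E <= rho I^perp <= dim I^perp], so [dim I <= dim B^perp].  It remains to
    see that 1 is the principal denominator of the dual: an integer-valued
    nonzero rank function takes the value 1 on some line
    ([integral_principal_denominator]).

    Part (b).  Applying [mu_basis_rank] to both bases gives [rho B = rho E] and
    [rho* B^perp = rho* E], and the latter unfolds to [rho E = dim B].  So [rho]
    is the dimension on the subspaces of [B].  If [B = 0], then [rho] vanishes.
    Otherwise [B] contains a line of rank 1, so [mu] is a positive integer; if
    [mu = 1] we are done.  If [mu > 1], the subspace [J] above satisfies
    [mu * dim (J :&: B) <= mu * rho J <= dim (J :&: B)], so [J] is a line of
    rank 0.  Therefore [E = B + L] with [rho L = 0], and [rho V] is the dimension
    of [(V + L) :&: B]. *)

(** * Orthogonal spaces of a non-degenerate symmetric form *)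

Section Orthogonal.

Variables (F : fieldType) (E : vectType F) (f : {symmetric E}).
Implicit Types V W : {vspace E}.

Lemma orthov_add V W : orthov f (V + W) = (orthov f V :&: orthov f W)%VS.
Proof.
apply/eqP; rewrite eqEsubv subv_cap -orthovD subvv /=.
by rewrite orthovD capvSl capvSr.
Qed.

(** Each vector of a spanning sequence of [V] cuts the dimension by at most
    one. *)
Lemma dim_cap_orthov V W : (\dim W <= \dim (W :&: orthov f V) + \dim V)%N.
Proof.
have seq_cut (X : seq E) U :
    (\dim U <= \dim (U :&: orthov f <<X>>) + size X)%N.
  elim: X U => [|x X IHX] U; first by rewrite span_nil orthov0 capvf addn0.
  rewrite span_cons orthov_add capvA /=.
  have := IHX (U :&: orthov f <[x]>)%VS; have := leq_dim_orthov1 f x U.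
  lia.
by have := seq_cut (vbasis V) W; rewrite (span_basis (vbasisP V)) size_tuple.
Qed.

Hypothesis hf : nondegenerate f.

Lemma dim_orthov V : (\dim (orthov f V) + \dim V = \dim {:E})%N.
Proof.
have lower := dim_cap_orthov V fullv; rewrite capfv in lower.
(* Non-degeneracy enters through a complement of V, which together with V cuts
   the orthogonal space down to the radical 0. *)
have upper := dim_cap_orthov (V^C)%VS (orthov f V).
rewrite -orthov_add addv_complf (eqP hf) dimv0 dimv_compl in upper.
have := dimvS (subvf V); lia.
Qed.

Lemma orthovK V : orthov f (orthov f V) = V.
Proof.
apply/eqP; rewrite eq_sym eqEdim orthov_sym subvv /=.
by have := dim_orthov V; have := dim_orthov (orthov f V); lia.
Qed.

Lemma orthov_cap V W : orthov f (V :&: W) = (orthov f V + orthov f W)%VS.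
Proof. by rewrite -[RHS]orthovK orthov_add !orthovK. Qed.

Lemma orthovS V W : (V <= W)%VS -> (orthov f W <= orthov f V)%VS.
Proof. by move=> sVW; rewrite orthov_sym orthovK. Qed.

Lemma orthovf : orthov f fullv = 0%VS.
Proof. exact/eqP. Qed.

End Orthogonal.

(** * Rank functions *)

Section Rank.

Variables (F : finFieldType) (E : vectType F) (rho : {vspace E} -> rat).
Hypothesis hrho : q_rank_function rho.
Implicit Types (V W J B L : {vspace E}) (mu nu : rat).

Lemma rank_ge0 V : 0 <= rho V.
Proof. by case: hrho => R1 _ _; case/andP: (R1 V). Qed.

Lemma rank_le_dim V : rho V <= (\dim V)%:R.
Proof. by case: hrho => R1 _ _; case/andP: (R1 V). Qed.

Lemma rankS V W : (V <= W)%VS -> rho V <= rho W.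
Proof. by case: hrho => _ R2 _; apply: R2. Qed.

Lemma rank_submod V W : rho (V + W)%VS + rho (V :&: W)%VS <= rho V + rho W.
Proof. by case: hrho => _ _ R3; apply: R3. Qed.

Lemma rank0 : rho 0%VS = 0.
Proof.
by have := rank_ge0 0%VS; have := rank_le_dim 0%VS; rewrite dimv0; lra.
Qed.

Lemma rank_add V W : rho (V + W)%VS <= rho V + rho W.
Proof. by have := rank_submod V W; have := rank_ge0 (V :&: W)%VS; lra. Qed.

(** The rank of a complement of [V] in [W] is at most its dimension. *)
Lemma rank_growth V W :
  (V <= W)%VS -> rho W + (\dim V)%:R <= rho V + (\dim W)%:R.
Proof.
move=> /capv_idPr capWV; have := addv_diff_cap W V; rewrite capWV => defW.
have := rank_add (W :\: V) V; have := rank_le_dim (W :\: V).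
by have := dimv_cap_compl W V; rewrite defW capWV => <-; rewrite natrD; lra.
Qed.

Lemma rank_eq_dimS V J : rho V = (\dim V)%:R -> (J <= V)%VS ->
  rho J = (\dim J)%:R.
Proof.
by move=> rV sJV; have := rank_growth sJV; have := rank_le_dim J; lra.
Qed.

(** Submodularity glues spaces containing [B] that have the same rank as [B]
    into a larger one, since their intersection contains [B] as well; the
    vectors of a basis of [E] can thus be added one after another. *)
Lemma rank_closure B :
  (forall v, rho (B + <[v]>)%VS <= rho B) -> rho fullv = rho B.
Proof.
move=> closB.
have closX (X : seq E) : rho (B + <<X>>)%VS <= rho B.
  elim: X => [|x X IHX]; first by rewrite span_nil addv0.
  have := rank_submod (B + <[x]>) (B + <<X>>).
  rewrite span_cons addvA (addvC _ B) !addvA addvv.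
  have sB : (B <= (B + <[x]>) :&: (B + <<X>>))%VS by rewrite subv_cap !addvSl.
  by have := rankS sB; have := closB x; lra.
have := closX (vbasis {:E}); rewrite (span_basis (vbasisP _)) addvf.
by have := rankS (subvf B); lra.
Qed.

(** A nonzero integer-valued rank function takes the value 1 on a line, since
    one that vanishes on lines is zero; evaluating there shows that any
    denominator is a positive integer. *)
Lemma integral_principal_denominator :
  (forall V, rho V \is a Num.nat) -> principal_denominator rho 1.
Proof.
move=> rN; split=> // rho_neq0.
split=> [|nu [nu_gt0 nuN]]; first by split=> // V; rewrite mul1r.
rewrite leNgt; apply/negP => nu_lt1; apply: rho_neq0.
suff rE0 : rho fullv = 0.
  by move=> V; have := rankS (subvf V); have := rank_ge0 V; lra.
rewrite -rank0; apply: rank_closure => v; rewrite add0v rank0.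
have := rank_le_dim <[v]>%VS; have := nuN <[v]>%VS.
case/natrP: (rN <[v]>%VS) => n ->; rewrite dim_vline ler_nat => /natrP[m].
case: n => [|[|n]] //; last by case: (v != 0).
rewrite mulr1 => def_nu; move: nu_gt0 nu_lt1; rewrite def_nu ltr0n ltrn1.
by case: m {def_nu}.
Qed.

Lemma integral_q_matroid : (forall V, rho V \is a Num.nat) -> q_matroid rho.
Proof. by move=> rN; split; last exact: integral_principal_denominator. Qed.

(** By maximality of [B] some [J] witnesses that [B + <v>] is dependent, and it
    is not contained in the independent space [B].  Integrality of [mu * rho J]
    sharpens the strict inequality [mu * rho J < dim J] to a bound by
    [dim J - 1]. *)
Lemma mu_basis_dependent mu B v : mu_basis rho mu B -> v \notin B ->
  exists J, [/\ (J + B = B + <[v]>)%VS, \dim J = (\dim (J :&: B)).+1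
              & mu * rho J <= (\dim (J :&: B))%:R].
Proof.
case=> -[mu_gt0 muN] indB maxB vB.
have dimBv : \dim (B + <[v]>) = (\dim B).+1.
  rewrite dimv_disjoint_sum; first rewrite dim_vline.
    by case: eqP vB => [->|]; rewrite ?mem0v ?addn1.
  apply/eqP; rewrite -subv0; apply/subvP => w /memv_capP[wB /vlineP[k def_w]].
  rewrite memv0 def_w; apply: contraNT vB; rewrite scaler_eq0 => /norP[k0 _].
  by rewrite -(scalerK k0 v) memvZ // -def_w.
have depBv : ~ mu_independent rho mu (B + <[v]>).
  by move=> /maxB; rewrite dimBv ltnn.
have [J nJ] := not_all_ex_not _ _ depBv.
have [sJ /negP] := imply_to_and _ _ nJ.
rewrite -ltNge ltr_pdivlMr // mulrC => ltJ.
have sJB : (B + J <= B + <[v]>)%VS by rewrite subv_add addvSl.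
have nsJB : ~~ (J <= B)%VS.
  apply: contraL ltJ => /indB; rewrite ler_pdivrMr // mulrC.
  by rewrite -leNgt.
have dimBJ : \dim (B + J) = (\dim B).+1.
  apply/eqP; rewrite eqn_leq -{1}dimBv dimvS //= ltnNge.
  apply: contra nsJB => leBJ.
  have -> : B = (B + J)%VS by apply/eqP; rewrite eqEdim addvSl.
  exact: addvSr.
have dimJ : \dim J = (\dim (J :&: B)).+1.
  by have := dimv_sum_cap J B; rewrite addvC dimBJ; lia.
exists J; split=> //.
  by apply/eqP; rewrite addvC eqEdim sJB dimBJ dimBv leqnn.
move: ltJ (muN J); rewrite dimJ => /[swap] /natrP[n ->].
by rewrite ltr_nat ler_nat.
Qed.

(** The dependence witness [J] satisfies [rho J = rho (J :&: B)], so that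
    submodularity for [J] and [B] bounds the rank of [J + B = B + <v>]. *)
Lemma mu_basis_rank mu B : mu_basis rho mu B -> rho fullv = rho B.
Proof.
move=> basB; have [[mu_gt0 _] indB _] := basB; apply: rank_closure => v.
have [vB | /(mu_basis_dependent basB)[J [<- _ leJ]]] := boolP (v \in B).
  by rewrite (addv_idPl _).
have := indB _ (capvSr J B); rewrite ler_pdivrMr // mulrC => geJB.
have := le_trans leJ geJB; rewrite ler_pM2l // => leJJB.
by have := rank_submod J B; lra.
Qed.

(** For [mu > 1] the space [J] of [mu_basis_dependent] is a loop, because it
    satisfies [mu * dim (J :&: B) <= dim (J :&: B)].  Adjoining loops one after
    another splits [E] as [B] plus a space of rank 0. *)
Lemma mu_basis_loops mu B : 1 < mu -> mu_basis rho mu B ->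
  rho B = (\dim B)%:R -> exists2 L, rho L = 0 & (B + L = fullv)%VS.
Proof.
move=> mu_gt1 basB rB.
have loop v : exists2 J, rho J = 0 & (v \in B + J)%VS.
  have [vB | /(mu_basis_dependent basB)] := boolP (v \in B).
    by exists 0%VS; [exact: rank0 | rewrite addv0].
  case=> J [defBv _ leJ]; exists J; last first.
    by rewrite addvC defBv memvE addvSr.
  have := rank_eq_dimS rB (capvSr J B); have := rankS (capvSl J B).
  have := rank_ge0 J; move: leJ; set d := (\dim _)%:R.
  by have : 0 <= d by []; nra.
suff [L rL sL] : exists2 L, rho L = 0 & (<<vbasis {:E}>> <= B + L)%VS.
  exists L => //; apply/eqP.
  by rewrite eqEsubv subvf -(span_basis (vbasisP {:E})).
elim: (tval (vbasis {:E})) => [|v X [L rL sL]].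
  by exists 0%VS; rewrite ?rank0 ?span_nil ?sub0v.
have [J rJ vJ] := loop v; exists (J + L)%VS.
  by have := rank_add J L; have := rank_ge0 (J + L)%VS; lra.
rewrite span_cons subv_add -memvE; apply/andP; split.
  by apply: subvP vJ; rewrite addvA addvSl.
by apply: subv_trans sL _; rewrite addvS ?addvSr.
Qed.

(** With [E = B + L] and [rho L = 0], the rank of [V] is that of the subspace
    [(V + L) :&: B] of [B], by the modular law. *)
Lemma rank_nat_of_loops B L V : rho B = (\dim B)%:R -> rho L = 0 ->
  (B + L = fullv)%VS -> rho V \is a Num.nat.
Proof.
move=> rB rL defE; pose U := ((V + L) :&: B)%VS.
have defVL : (U + L = V + L)%VS.
  by rewrite /U vspace_modr ?addvSr // defE capvf.
have <- : rho U = rho V.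
  have := rank_add U L; have := rank_add V L; have := rankS (addvSl V L).
  have := rankS (addvSl U L); rewrite defVL.
  by have := rankS (capvSl (V + L) B); rewrite -/U; lra.
by rewrite (rank_eq_dimS rB (capvSr _ _)) natr_nat.
Qed.

(** If [mu] is 1, integrality is that of [mu * rho V]; if [mu > 1], it comes from
    the splitting of [E] by loops.  No [mu] strictly between 0 and 1 can occur
    unless [rho] vanishes, because otherwise [B] has a line of rank 1. *)
Lemma mu_basis_full_rank_nat mu B V : mu_basis rho mu B ->
  rho B = (\dim B)%:R -> rho V \is a Num.nat.
Proof.
move=> basB rB; have [[mu_gt0 muN] _ _] := basB.
have [B0 | Bneq0] := eqVneq B 0%VS.
  have rE := mu_basis_rank basB; have := rankS (subvf V).
  rewrite rE rB B0 dimv0 => leV.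
  by have -> : rho V = 0 by have := rank_ge0 V; lra.
(* A line of B has rank 1, so mu itself is an integer. *)
have /natrP[m def_mu] : mu \is a Num.nat.
  have sl : (<[vpick B]> <= B)%VS by rewrite -memvE memv_pick.
  have := muN <[vpick B]>%VS; rewrite (rank_eq_dimS rB sl) dim_vline.
  by rewrite vpick0 Bneq0 mulr1.
case: m def_mu => [|[|m]] def_mu; first by lra.
  by have := muN V; rewrite def_mu mul1r.
have mu_gt1 : 1 < mu by rewrite def_mu ltr1n.
have [L rL defE] := mu_basis_loops mu_gt1 basB rB.
exact: rank_nat_of_loops rB rL defE.
Qed.

End Rank.

(** * Duality *)

Section Dual.

Variables (F : finFieldType) (E : vectType F) (rho : {vspace E} -> rat).
Variable f : {symmetric E}.
Hypotheses (hrho : q_rank_function rho) (hf : nondegenerate f).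
Implicit Types V W : {vspace E}.

(** Passing from [V] to its orthogonal space exchanges sums and intersections,
    which keeps submodularity; monotonicity and nonnegativity hold because the
    rank grows no faster than the dimension. *)
Lemma dual_q_rank_function : q_rank_function (dual_rank f rho).
Proof.
have dimD V : (\dim {:E})%:R = (\dim (orthov f V))%:R + (\dim V)%:R :> rat.
  by rewrite -natrD dim_orthov.
split=> [V | V W sVW | V W]; rewrite /dual_rank.
- have := rank_growth hrho (subvf (orthov f V)); rewrite (dimD V).
  by have := rankS hrho (subvf (orthov f V)); lra.
- have := rank_growth hrho (orthovS hf sVW).
  by have := dimD V; have := dimD W; lra.
- have : (\dim (V + W))%:R + (\dim (V :&: W))%:R
         = (\dim V)%:R + (\dim W)%:R :> rat.
    by rewrite -!natrD dimv_sum_cap.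
  have := rank_submod hrho (orthov f V) (orthov f W).
  by rewrite orthov_add orthov_cap //; lra.
Qed.

Lemma dual_rank_nat : (forall V, rho V \is a Num.nat) ->
  forall V, dual_rank f rho V \is a Num.nat.
Proof.
move=> rN V; rewrite natrEint (rank_ge0 dual_q_rank_function) andbT.
by rewrite rpredB ?rpredD // intr_nat ?natr_nat.
Qed.

(** With [rho B = dim B = rho E], independence of a space [I] in the dual amounts
    to [rho (orthov f I) = rho E], which needs [dim (orthov f I) >= dim B]. *)
Lemma dual_basis B : mu_basis rho 1 B ->
  mu_basis (dual_rank f rho) 1 (orthov f B).
Proof.
move=> basB; have [[_ rN] indB _] := basB.
have rE := mu_basis_rank hrho basB.
have rB : rho B = (\dim B)%:R.
  have := indB B (subvv B); rewrite divr1.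
  by have := rank_le_dim hrho B; lra.
have drB : dual_rank f rho (orthov f B) = (\dim (orthov f B))%:R.
  by rewrite /dual_rank orthovK // rE; lra.
split=> [|J sJ|I /(_ I (subvv I))].
- split=> // V; rewrite mul1r dual_rank_nat // => W.
  by have := rN W; rewrite mul1r.
- by rewrite divr1 (rank_eq_dimS dual_q_rank_function drB sJ).
rewrite divr1 /dual_rank rE rB => indI.
have : (\dim B)%:R <= (\dim (orthov f I))%:R :> rat.
  by have := rank_le_dim hrho (orthov f I); lra.
by rewrite ler_nat; have := dim_orthov hf I; have := dim_orthov hf B; lia.
Qed.

End Dual.

(** * Bases and their orthogonal spaces *)

Theorem proposition5p5 (F : finFieldType) (E : vectType F)
    (rho : {vspace E} -> rat) (hrho : q_rank_function rho)
    (f : {symmetric E}) (hf : nondegenerate f) :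
  (q_matroid rho ->
     forall B : {vspace E}, basis rho B -> basis (dual_rank f rho) (orthov f B))
  /\
  (forall mu : rat, denominator rho mu ->
     (exists B : {vspace E},
        mu_basis rho mu B /\ mu_basis (dual_rank f rho) mu (orthov f B)) ->
     q_matroid rho).
Proof.
split=> [matr B [mu pmu basB] | mu _ [B [basB basBd]]].
  have drf := dual_q_rank_function hrho hf.
  have mu1 : mu = 1.
    have [zero_mu one_mu] := pmu; have [_ [_ one_1]] := matr.
    have [r0 | rneq0] := classic (forall V, rho V = 0); first exact: zero_mu.
    have [den_mu le_mu] := one_mu rneq0; have [den_1 le_1] := one_1 rneq0.
    by apply/eqP; rewrite eq_le le_mu // le_1.
  rewrite mu1 in basB; have basBd := dual_basis hrho hf basB.
  exists 1 => //; have [[_ dN] _ _] := basBd.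
  apply: integral_principal_denominator => // V.
  by have := dN V; rewrite mul1r.
apply: integral_q_matroid => // V.
have rE := mu_basis_rank hrho basB.
have := mu_basis_rank (dual_q_rank_function hrho hf) basBd.
rewrite /dual_rank orthovK // orthovf // rank0 // => drE.
have rB : rho B = (\dim B)%:R.
  by move: drE; rewrite -(dim_orthov hf B) natrD; lra.
exact: mu_basis_full_rank_nat basB rB.
Qed.
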